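(* Let $\omega$ be a weight function whose associated weight matrix $\{W^x\}_{x>0}$ satisfies $$\forall x>0\ \exists y>0\ \exists A>0\ \forall k\ge1:\ \vartheta^x_k\le A\,(W^y_k)^{1/k}.$$ Then $\omega$ is good if and only if $\omega$ is equivalent to its least concave majorant.
   Context: A weight function is a continuous increasing $\omega:[0,\infty)\to[0,\infty)$ with $\omega(0)=0$, $\omega(t)\to\infty$, $\omega(2t)=O(\omega(t))$, $\omega(t)=O(t)$, $\log t=o(\omega(t))$, and $\varphi(t)=\omega(e^t)$ convex; normalized with $\omega|_{[0,1]}=0$, $\varphi^*(t)=\sup_{s\ge0}(st-\varphi(s))$, weight matrix $W^x_k=\exp(\frac1x\varphi^*(xk))$, $\vartheta^x_k=W^x_k/W^x_{k-1}$. $\omega$ is good if $\forall x>0\ \exists y>0\ \exists C\ge1\ \forall 1\le j\le k:\ \vartheta^x_j/j\le C\vartheta^y_k/k$. Two functions $\omega,\sigma$ are equivalent if $\omega=O(\sigma)$ and $\sigma=O(\omega)$ as $t\to\infty$. *)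

(* Defs.v *)
From Stdlib Require Import Reals Lra ClassicalDescription.
Open Scope R_scope.

(* Supremum of a set of reals (0 if empty or unbounded above; only used
   where the set is nonempty and bounded). *)
Definition Rsup (E : R -> Prop) : R :=
  match excluded_middle_informative (bound E /\ exists x, E x) with
  | left H => proj1_sig (completeness E (proj1 H) (proj2 H))
  | right _ => 0
  end.

Definition cont_on_nonneg (w : R -> R) : Prop :=
  forall t, 0 <= t -> forall eps, 0 < eps -> exists delta, 0 < delta /\
    forall s, 0 <= s -> Rabs (s - t) < delta -> Rabs (w s - w t) < eps.

Definition convex_R (f : R -> R) : Prop :=
  forall a b l, 0 <= l <= 1 ->
    f (l * a + (1 - l) * b) <= l * f a + (1 - l) * f b.

Definition phi_of (w : R -> R) (t : R) : R := w (exp t).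

Definition weight_function (w : R -> R) : Prop :=
  cont_on_nonneg w /\
  (forall s t, 0 <= s -> s <= t -> w s <= w t) /\
  (forall t, 0 <= t -> 0 <= w t) /\
  w 0 = 0 /\
  (forall M, exists T, forall t, T <= t -> M <= w t) /\
  (exists C T, forall t, T <= t -> Rabs (w (2 * t)) <= C * Rabs (w t)) /\
  (exists C T, forall t, T <= t -> Rabs (w t) <= C * Rabs t) /\
  (forall eps, 0 < eps -> exists T, forall t, T <= t ->
      Rabs (ln t) <= eps * Rabs (w t)) /\
  convex_R (phi_of w).

Definition normalized (w : R -> R) : Prop :=
  forall t, 0 <= t <= 1 -> w t = 0.

Definition phi_star (w : R -> R) (t : R) : R :=
  Rsup (fun v => exists s, 0 <= s /\ v = s * t - phi_of w s).

Definition W (w : R -> R) (x : R) (k : nat) : R :=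
  exp (/ x * phi_star w (x * INR k)).

(* theta^x_k = W^x_k / W^x_{k-1}  (used for k >= 1). *)
Definition theta (w : R -> R) (x : R) (k : nat) : R :=
  W w x k / W w x (k - 1).

Definition good (w : R -> R) : Prop :=
  forall x, 0 < x -> exists y, 0 < y /\ exists C, 1 <= C /\
    forall j k : nat, (1 <= j)%nat -> (j <= k)%nat ->
      theta w x j / INR j <= C * (theta w y k / INR k).

Definition theta_root_condition (w : R -> R) : Prop :=
  forall x, 0 < x -> exists y, 0 < y /\ exists A, 0 < A /\
    forall k : nat, (1 <= k)%nat ->
      theta w x k <= A * Rpower (W w y k) (/ INR k).

Definition concave_on_nonneg (h : R -> R) : Prop :=
  forall a b l, 0 <= a -> 0 <= b -> 0 <= l <= 1 ->
    l * h a + (1 - l) * h b <= h (l * a + (1 - l) * b).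

Definition concave_majorant (w h : R -> R) : Prop :=
  concave_on_nonneg h /\ forall t, 0 <= t -> w t <= h t.

Definition least_concave_majorant (w kappa : R -> R) : Prop :=
  concave_majorant w kappa /\
  forall h, concave_majorant w h -> forall t, 0 <= t -> kappa t <= h t.

Definition equivalent (w s : R -> R) : Prop :=
  (exists C T, forall t, T <= t -> Rabs (w t) <= C * Rabs (s t)) /\
  (exists C T, forall t, T <= t -> Rabs (s t) <= C * Rabs (w t)).

(* Main.v *)
(* With [phi s = w (e^s)], both properties are compared with the growth bound [w (l t) = O(l (w t + 1))].
   Summing the logarithms of the goodness inequality in blocks of length about [l] bounds
   [k (s + ln l) - ln W^y_k] by [O(l)] times the Legendre-type supremum of [k s - ln W^x_k]; since
   biconjugation recovers [phi] from these suprema up to an error [O(s)], the growth bound follows.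
   It yields affine majorants of [w] whose value at [t] is [O(w t)], so the least concave majorant is
   equivalent to [w]; conversely a concave function that is nonnegative at 0 satisfies [h (l t) <= l h t] for [l >= 1].
   Finally, conjugating [phi (s + l) <= E e^l (phi s + 1)] shows that [(W^y_k)^(1/k) / k] is increasing in
   [k] up to a constant factor, and the root condition together with [(W^y_k)^(1/k) <= theta^y_k] turns
   this into goodness. *)
Require Import Defs.
From Stdlib Require Import Reals ZArith Lra Lia ClassicalDescription.
Open Scope R_scope.

(** * Suprema, subgradients and concave majorants *)

Lemma Rsup_ge (E : R -> Prop) (v : R) : bound E -> E v -> v <= Rsup E.
Proof.
  intros Hb Hv. unfold Rsup.
  destruct (excluded_middle_informative _) as [H|H].
  - destruct (completeness E (proj1 H) (proj2 H)) as [m [Hm Hl]]; simpl. exact (Hm v Hv).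
  - exfalso. apply H. split; [exact Hb | exists v; exact Hv].
Qed.

Lemma Rsup_le (E : R -> Prop) (M : R) :
  (exists v, E v) -> (forall v, E v -> v <= M) -> Rsup E <= M.
Proof.
  intros Hv HM. unfold Rsup.
  destruct (excluded_middle_informative _) as [H|H].
  - destruct (completeness E (proj1 H) (proj2 H)) as [m [Hm Hl]]; simpl. exact (Hl M HM).
  - exfalso. apply H. split; [exists M; exact HM | exact Hv].
Qed.

Lemma ln_nonneg (r : R) : 1 <= r -> 0 <= ln r.
Proof.
  intros Hr. rewrite <- ln_1.
  destruct Hr as [Hr|Hr]; [left; apply ln_increasing; lra | rewrite <- Hr; lra].
Qed.

Lemma exp_ge_1 (r : R) : 0 <= r -> 1 <= exp r.
Proof. intros Hr. pose proof (exp_ineq1_le r). lra. Qed.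

(** The supremum of the difference quotients to the left of [s] serves as [u]: by convexity each of
    them is at most every quotient to the right. *)
Lemma convex_R_subgradient (f : R -> R) (s : R) :
  convex_R f -> exists u, forall r, f s + u * (r - s) <= f r.
Proof.
  intros Hf.
  assert (Hslope : forall r t, r < s -> s < t -> (f s - f r) / (s - r) <= (f t - f s) / (t - s)).
  { intros r t Hr Ht.
    assert (Hc : f s <= (t - s) / (t - r) * f r + (s - r) / (t - r) * f t).
    { pose proof (Hf r t ((t - s) / (t - r))) as H.
      replace ((t - s) / (t - r) * r + (1 - (t - s) / (t - r)) * t) with s in H by (field; lra).
      replace (1 - (t - s) / (t - r)) with ((s - r) / (t - r)) in H by (field; lra).
      apply H. split; [apply Rmult_le_pos; [lra | left; apply Rinv_0_lt_compat; lra]|].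
      apply Rmult_le_reg_r with (t - r); [lra|]. field_simplify; lra. }
    assert (Hc' : f s * (t - r) <= (t - s) * f r + (s - r) * f t).
    { apply Rmult_le_compat_r with (r := t - r) in Hc; [|lra].
      eapply Rle_trans; [exact Hc|]. right; field; lra. }
    apply Rmult_le_reg_r with ((s - r) * (t - s)); [apply Rmult_lt_0_compat; lra|].
    field_simplify; [|lra|lra]. nra. }
  set (E := fun v => exists r, r < s /\ v = (f s - f r) / (s - r)).
  assert (Hne : exists v, E v) by (exists ((f s - f (s - 1)) / (s - (s - 1))), (s - 1); split; [lra|reflexivity]).
  assert (Hle : forall t, s < t -> forall v, E v -> v <= (f t - f s) / (t - s)).
  { intros t Ht v [r [Hr ->]]. apply Hslope; assumption. }
  assert (Hb : bound E).
  { exists ((f (s + 1) - f s) / (s + 1 - s)). intros v Hv. apply Hle; [lra|exact Hv]. }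
  exists (Rsup E). intros r.
  destruct (Rtotal_order r s) as [H|[H|H]].
  - assert (Hv : (f s - f r) / (s - r) <= Rsup E).
    { apply Rsup_ge; [exact Hb|]. exists r; split; [exact H|reflexivity]. }
    apply Rmult_le_compat_r with (r := s - r) in Hv; [|lra].
    replace ((f s - f r) / (s - r) * (s - r)) with (f s - f r) in Hv by (field; lra). lra.
  - subst r. lra.
  - assert (Hv : Rsup E <= (f r - f s) / (r - s)).
    { apply Rsup_le; [exact Hne|]. apply Hle, H. }
    apply Rmult_le_compat_r with (r := r - s) in Hv; [|lra].
    replace ((f r - f s) / (r - s) * (r - s)) with (f r - f s) in Hv by (field; lra). lra.
Qed.

Lemma concave_on_nonneg_affine (a b : R) : concave_on_nonneg (fun t => a + b * t).
Proof. intros s t l _ _ _. right. ring. Qed.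

(** The pointwise infimum of all concave majorants works. It is written as minus the supremum of the
    negated values, a set that [h0] makes nonempty and [w] bounds. *)
Lemma least_concave_majorant_exists (w h0 : R -> R) :
  concave_majorant w h0 -> exists kappa, least_concave_majorant w kappa.
Proof.
  intros Hh0.
  set (E := fun t v => exists h, concave_majorant w h /\ v = - h t).
  assert (Hge : forall h t, concave_majorant w h -> 0 <= t -> - h t <= Rsup (E t)).
  { intros h t Hh Ht. apply Rsup_ge.
    - exists (- w t). intros v [g [[_ Hg] ->]]. specialize (Hg t Ht). lra.
    - exists h. split; [exact Hh|reflexivity]. }
  assert (Hle : forall t M, (forall h, concave_majorant w h -> - h t <= M) -> Rsup (E t) <= M).
  { intros t M HM. apply Rsup_le.
    - exists (- h0 t), h0. split; [exact Hh0|reflexivity].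
    - intros v [h [Hh ->]]. apply HM, Hh. }
  exists (fun t => - Rsup (E t)). split; [split|].
  - intros a b l Ha Hb Hl.
    assert (H : Rsup (E (l * a + (1 - l) * b)) <= l * Rsup (E a) + (1 - l) * Rsup (E b)); [|lra].
    apply Hle. intros h Hh.
    pose proof (Hge h a Hh Ha). pose proof (Hge h b Hh Hb).
    pose proof (proj1 Hh a b l Ha Hb Hl). nra.
  - intros t Ht. assert (Rsup (E t) <= - w t); [|lra].
    apply Hle. intros h [_ Hh]. specialize (Hh t Ht). lra.
  - intros h Hh t Ht. specialize (Hge h t Hh Ht). lra.
Qed.

(** * Weight functions and the Young conjugate *)

Lemma weight_function_monotone (w : R -> R) (s t : R) :
  weight_function w -> 0 <= s -> s <= t -> w s <= w t.
Proof. intros (_ & H & _). apply H. Qed.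

Lemma weight_function_nonneg (w : R -> R) (t : R) : weight_function w -> 0 <= t -> 0 <= w t.
Proof. intros (_ & _ & H & _). apply H. Qed.

Lemma phi_of_nonneg (w : R -> R) (s : R) : weight_function w -> 0 <= phi_of w s.
Proof. intros Hw. exact (weight_function_nonneg w (exp s) Hw (Rlt_le _ _ (exp_pos s))). Qed.

Lemma phi_of_0 (w : R -> R) : normalized w -> phi_of w 0 = 0.
Proof. intros Hn. unfold phi_of. rewrite exp_0. apply Hn. lra. Qed.

(** The affine function is a first concave majorant; it also makes the error
    [phi_of w (ln (INR N / C))] linear in [N]. *)
Lemma weight_function_affine_bound (w : R -> R) :
  weight_function w -> exists a, 0 <= a /\ forall t, 0 <= t -> w t <= a + a * t.
Proof.
  intros Hw. pose proof Hw as (_ & _ & _ & _ & _ & _ & (C & T & H) & _).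
  assert (HT0 : 0 <= w (Rmax T 0)) by (apply weight_function_nonneg; [exact Hw|apply Rmax_r]).
  exists (Rmax C 0 + w (Rmax T 0)). pose proof (Rmax_r C 0). pose proof (Rmax_l C 0).
  split; [lra|]. intros t Ht.
  destruct (Rle_dec T t) as [HT|HT].
  - specialize (H t HT). rewrite (Rabs_pos_eq t Ht) in H.
    rewrite (Rabs_pos_eq (w t)) in H by (apply weight_function_nonneg; assumption). nra.
  - assert (w t <= w (Rmax T 0)); [|nra].
    apply weight_function_monotone; [exact Hw|exact Ht|]. pose proof (Rmax_l T 0). lra.
Qed.

(** This is [log t = o(w t)] with [eps = 1 / (u + 1)]. It bounds the set defining [phi_star w u], so
    [Rsup] does not fall back to its default 0. *)
Lemma phi_of_superlinear (w : R -> R) (u : R) :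
  weight_function w -> 0 <= u ->
  exists M, 0 <= M /\ forall s, 0 <= s -> s * u <= phi_of w s + M.
Proof.
  intros Hw Hu. pose proof Hw as (_ & _ & _ & _ & _ & _ & _ & H & _).
  destruct (H (/ (u + 1))) as [T HT]; [apply Rinv_0_lt_compat; lra|].
  set (S := Rmax T 1). assert (HS1 : 1 <= S) by apply Rmax_r. assert (HST : T <= S) by apply Rmax_l.
  assert (HlS : 0 <= ln S) by (apply ln_nonneg; exact HS1).
  (* This constant covers [s <= ln S]; beyond it [s * (u + 1) <= phi_of w s]. *)
  exists (ln S * u). split; [nra|].
  intros s Hs. pose proof (phi_of_nonneg w s Hw) as Hp.
  destruct (Rle_dec s (ln S)) as [h|h]; [nra|].
  assert (Hes : S <= exp s).
  { rewrite <- (exp_ln S) by lra. left. apply exp_increasing. lra. }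
  specialize (HT (exp s)). rewrite ln_exp, (Rabs_pos_eq s Hs) in HT.
  fold (phi_of w s) in HT. rewrite (Rabs_pos_eq (phi_of w s) Hp) in HT.
  assert (HT' : s <= / (u + 1) * phi_of w s) by (apply HT; lra).
  apply Rmult_le_compat_r with (r := u + 1) in HT'; [|lra].
  replace (/ (u + 1) * phi_of w s * (u + 1)) with (phi_of w s) in HT' by (field; lra).
  nra.
Qed.

Lemma fenchel_young (w : R -> R) (s u : R) :
  weight_function w -> 0 <= s -> 0 <= u -> s * u - phi_of w s <= phi_star w u.
Proof.
  intros Hw Hs Hu. apply Rsup_ge.
  - destruct (phi_of_superlinear w u Hw Hu) as (M & _ & HM). exists M.
    intros v [r [Hr ->]]. specialize (HM r Hr). lra.
  - exists s. split; [exact Hs|reflexivity].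
Qed.

Lemma phi_star_le (w : R -> R) (u M : R) :
  (forall s, 0 <= s -> s * u - phi_of w s <= M) -> phi_star w u <= M.
Proof.
  intros H. apply Rsup_le.
  - exists (0 * u - phi_of w 0), 0. split; [lra|reflexivity].
  - intros v [s [Hs ->]]. apply H, Hs.
Qed.

Lemma phi_star_0 (w : R -> R) : weight_function w -> normalized w -> phi_star w 0 = 0.
Proof.
  intros Hw Hn. apply Rle_antisym.
  - apply phi_star_le. intros s Hs. pose proof (phi_of_nonneg w s Hw). lra.
  - pose proof (fenchel_young w 0 0 Hw (Rle_refl 0) (Rle_refl 0)) as H.
    rewrite phi_of_0 in H by exact Hn. lra.
Qed.

Lemma phi_star_monotone (w : R -> R) (u v : R) :
  weight_function w -> 0 <= u -> u <= v -> phi_star w u <= phi_star w v.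
Proof.
  intros Hw Hu Huv. apply phi_star_le. intros s Hs.
  pose proof (fenchel_young w s v Hw Hs ltac:(lra)). nra.
Qed.

(** Since [phi_of w] is nonnegative, [s * (l * u) - phi_of w s] is at most
    [l * (s * u - phi_of w s)] for [l <= 1]. *)
Lemma phi_star_star_shaped (w : R -> R) (u l : R) :
  weight_function w -> 0 <= u -> 0 <= l <= 1 -> phi_star w (l * u) <= l * phi_star w u.
Proof.
  intros Hw Hu Hl. apply phi_star_le. intros s Hs.
  pose proof (fenchel_young w s u Hw Hs Hu). pose proof (phi_of_nonneg w s Hw). nra.
Qed.

(** Take for [u] a subgradient of [phi_of w] at [s]: the supremum defining [phi_star w u] is then
    attained at [s], and monotonicity makes [u] nonnegative. *)
Lemma phi_of_biconjugate (w : R -> R) (s : R) :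
  weight_function w -> 0 <= s -> exists u, 0 <= u /\ phi_of w s <= s * u - phi_star w u.
Proof.
  intros Hw Hs. pose proof Hw as (_ & _ & _ & _ & _ & _ & _ & _ & Hc).
  destruct (convex_R_subgradient _ s Hc) as [u Hu].
  exists u. split.
  - specialize (Hu (s - 1)).
    assert (phi_of w (s - 1) <= phi_of w s); [|lra].
    apply (weight_function_monotone w); [exact Hw|left; apply exp_pos|].
    left. apply exp_increasing. lra.
  - assert (phi_star w u <= s * u - phi_of w s); [|lra].
    apply phi_star_le. intros r Hr. specialize (Hu r). lra.
Qed.

(** * Logarithms of the weight matrix *)

Definition log_W (w : R -> R) (x : R) (k : nat) : R := / x * phi_star w (x * INR k).

Lemma W_exp_log_W (w : R -> R) (x : R) (k : nat) : W w x k = exp (log_W w x k).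
Proof. reflexivity. Qed.

Lemma theta_exp (w : R -> R) (x : R) (k : nat) :
  theta w x k = exp (log_W w x k - log_W w x (k - 1)).
Proof.
  unfold theta. rewrite !W_exp_log_W. unfold Rminus. rewrite exp_plus, exp_Ropp. reflexivity.
Qed.

Lemma log_W_0 (w : R -> R) (x : R) : weight_function w -> normalized w -> log_W w x 0 = 0.
Proof. intros Hw Hn. unfold log_W. simpl. rewrite Rmult_0_r, phi_star_0; [lra|exact Hw|exact Hn]. Qed.

Lemma log_W_fenchel_young (w : R -> R) (x s : R) (k : nat) :
  weight_function w -> 0 < x -> 0 <= s -> INR k * s - log_W w x k <= phi_of w s / x.
Proof.
  intros Hw Hx Hs. unfold log_W.
  pose proof (fenchel_young w s (x * INR k) Hw Hs ltac:(pose proof (pos_INR k); nra)) as H.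
  apply Rmult_le_reg_l with x; [exact Hx|]. field_simplify; lra.
Qed.

(** For [j >= 1] this is monotonicity of the roots [(W^x_k)^(1/k)]; with [j = k - 1] it gives
    [(W^x_k)^(1/k) <= theta^x_k]. *)
Lemma log_W_root_le (w : R -> R) (x : R) (j k : nat) :
  weight_function w -> 0 < x -> (j <= k)%nat -> (1 <= k)%nat ->
  log_W w x j <= INR j / INR k * log_W w x k.
Proof.
  intros Hw Hx Hjk Hk. apply le_INR in Hk, Hjk. simpl in Hk. pose proof (pos_INR j).
  assert (Hl : 0 <= INR j / INR k <= 1).
  { split; [apply Rmult_le_pos; [lra|left; apply Rinv_0_lt_compat; lra]|].
    apply Rmult_le_reg_r with (INR k); [lra|]. field_simplify; lra. }
  pose proof (phi_star_star_shaped w (x * INR k) (INR j / INR k) Hw ltac:(nra) Hl) as H0.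
  replace (INR j / INR k * (x * INR k)) with (x * INR j) in H0 by (field; lra).
  unfold log_W. apply Rmult_le_compat_l with (r := / x) in H0; [lra|].
  left. apply Rinv_0_lt_compat, Hx.
Qed.

(** * The growth bound, and its derivation from goodness *)

(* [w (l t) = O(l (w t + 1))] is Peetre's criterion for [w] being equivalent to a concave function;
   the additive [1] spares a threshold on [t]. *)
Definition concave_growth (w : R -> R) : Prop :=
  exists E, 1 <= E /\ forall t l, 1 <= t -> 1 <= l -> w (l * t) <= E * l * (w t + 1).

(* The sums are compared in blocks of length [N]: goodness bounds the increments of [log_W w y] over the
   [q]-th block from below by [ln (N / C)] plus the [q]-th increment of [log_W w x]. *)
Lemma good_block_bound (w : R -> R) (x y C s : R) (N q r : nat) :
  weight_function w -> normalized w -> 0 < y -> 1 <= C ->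
  (forall j k : nat, (1 <= j)%nat -> (j <= k)%nat ->
     theta w x j / INR j <= C * (theta w y k / INR k)) ->
  C <= INR N -> 0 <= s -> (1 <= q)%nat -> (r <= N)%nat ->
  INR (q * N + r - 1) * (s + ln (INR N / C)) - log_W w y (q * N + r - 1)
  <= INR N * s + phi_of w (ln (INR N / C)) / y
     + INR N * (INR (q - 1) * s - log_W w x (q - 1))
     + INR r * (s - (log_W w x q - log_W w x (q - 1))).
Proof.
  intros Hw Hn Hy HC Hgood HN Hs Hq. set (l := ln (INR N / C)).
  assert (HN1 : (1 <= N)%nat) by (apply INR_le; simpl; lra).
  assert (HNC : 1 <= INR N / C).
  { apply Rmult_le_reg_r with C; [lra|]. field_simplify; lra. }
  assert (Hl : 0 <= l) by (apply ln_nonneg; exact HNC).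
  (* An index [k = q * N + r] satisfies [k / q >= N], so goodness for the pair [q <= k] gains the
     factor [N / C] throughout the block. *)
  assert (Hstep : forall q r, (1 <= q)%nat ->
    log_W w x q - log_W w x (q - 1) + l
    <= log_W w y (q * N + r) - log_W w y (q * N + r - 1)).
  { clear q Hq r. intros q r Hq.
    assert (Hqi : (q <= q * N + r)%nat) by nia.
    specialize (Hgood q (q * N + r)%nat Hq Hqi). rewrite !theta_exp in Hgood.
    set (a := log_W w x q - log_W w x (q - 1)) in *.
    set (b := log_W w y (q * N + r) - log_W w y (q * N + r - 1)) in *.
    apply le_INR in Hq. simpl in Hq.
    assert (Hi : INR q * INR N <= INR (q * N + r)).
    { rewrite plus_INR, mult_INR. pose proof (pos_INR r). lra. }
    assert (Hi0 : 0 < INR (q * N + r)) by nra.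
    assert (Hexp : exp (a + l) <= exp b).
    { rewrite exp_plus. unfold l. rewrite exp_ln by lra.
      pose proof (exp_pos a) as Ha.
      apply Rmult_le_compat_r with (r := INR q * INR (q * N + r)) in Hgood; [|nra].
      replace (exp a / INR q * (INR q * INR (q * N + r))) with (exp a * INR (q * N + r))
        in Hgood by (field; lra).
      replace (C * (exp b / INR (q * N + r)) * (INR q * INR (q * N + r)))
        with (C * exp b * INR q) in Hgood by (field; lra).
      assert (H : exp a * INR N <= C * exp b).
      { apply Rmult_le_reg_r with (INR q); [lra|].
        apply Rle_trans with (exp a * INR (q * N + r)); [nra|exact Hgood]. }
      apply Rmult_le_reg_r with C; [lra|]. field_simplify; [lra|lra]. }
    destruct (Rle_dec (a + l) b) as [h|h]; [exact h|].
    pose proof (exp_increasing b (a + l)). lra. }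
  (* Outer induction on the block, inner induction on the number [r] of its indices already summed;
     a full block [r = N] is the start [r = 0] of the next one. *)
  revert r. induction q as [|[|q] IH]; [lia| |].
  - intros r. induction r as [|r IHr]; intros Hr.
    (* The indices below [N] precede all blocks; Fenchel-Young at [l] bounds their contribution. *)
    + replace (1 * N + 0 - 1)%nat with (N - 1)%nat by lia.
      replace (1 - 1)%nat with 0%nat by lia. rewrite log_W_0 by assumption.
      pose proof (log_W_fenchel_young w y l (N - 1) Hw Hy Hl) as H.
      pose proof (le_INR (N - 1) N ltac:(lia)). simpl (INR 0). nra.
    + specialize (IHr ltac:(lia)). specialize (Hstep 1%nat r ltac:(lia)).
      replace (1 * N + S r - 1)%nat with (1 * N + r)%nat by lia.
      assert (HS : INR (1 * N + r) = INR (1 * N + r - 1) + 1).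
      { rewrite <- S_INR. f_equal. lia. }
      rewrite HS, (S_INR r). lra.
  - specialize (IH ltac:(lia)). intros r. induction r as [|r IHr]; intros Hr.
    + specialize (IH N (Nat.le_refl N)).
      replace (S (S q) * N + 0 - 1)%nat with (S q * N + N - 1)%nat by nia.
      replace (S (S q) - 1)%nat with (S q) by lia.
      replace (S q - 1)%nat with q in IH by lia.
      rewrite (S_INR q). simpl (INR 0). lra.
    + specialize (IHr ltac:(lia)). specialize (Hstep (S (S q)) r ltac:(lia)).
      replace (S (S q) * N + S r - 1)%nat with (S (S q) * N + r)%nat by lia.
      assert (HS : INR (S (S q) * N + r) = INR (S (S q) * N + r - 1) + 1).
      { rewrite <- S_INR. f_equal. nia. }
      rewrite HS, (S_INR r). lra.
Qed.

(** The last two terms of [good_block_bound] are [N] times a linear interpolation between the values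
    of [INR k * s - log_W w x k] at [k = q - 1] and [k = q]; Fenchel-Young bounds both values by
    [phi_of w s / x]. *)
Lemma good_conjugate_bound (w : R -> R) (x y C s : R) (N K : nat) :
  weight_function w -> normalized w -> 0 < x -> 0 < y -> 1 <= C ->
  (forall j k : nat, (1 <= j)%nat -> (j <= k)%nat ->
     theta w x j / INR j <= C * (theta w y k / INR k)) ->
  C <= INR N -> 0 <= s ->
  INR K * (s + ln (INR N / C)) - log_W w y K
  <= INR N * s + phi_of w (ln (INR N / C)) / y + INR N * (phi_of w s / x).
Proof.
  intros Hw Hn Hx Hy HC Hgood HN Hs.
  assert (HN1 : (1 <= N)%nat) by (apply INR_le; simpl; lra).
  assert (HNC : 1 <= INR N / C).
  { apply Rmult_le_reg_r with C; [lra|]. field_simplify; lra. }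
  assert (Hl : 0 <= ln (INR N / C)) by (apply ln_nonneg; exact HNC).
  assert (HF : 0 <= phi_of w s / x).
  { apply Rmult_le_pos; [apply phi_of_nonneg, Hw|left; apply Rinv_0_lt_compat, Hx]. }
  destruct (Nat.lt_ge_cases K N) as [HK|HK].
  - pose proof (log_W_fenchel_young w y _ K Hw Hy Hl).
    apply lt_INR in HK. nra.
  - pose proof (Nat.div_mod_eq K N) as Hdm.
    pose proof (Nat.mod_upper_bound K N ltac:(lia)) as Hmod.
    set (q := (K / N)%nat) in *. set (r := (K mod N)%nat) in *.
    assert (Hq : (1 <= q)%nat) by nia.
    (* The shift to [S r] makes [K] itself the last index summed. *)
    pose proof (good_block_bound w x y C s N q (S r) Hw Hn Hy HC Hgood HN Hs Hq ltac:(lia)) as H.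
    replace (q * N + S r - 1)%nat with K in H by lia.
    pose proof (log_W_fenchel_young w x s q Hw Hx Hs) as H1.
    pose proof (log_W_fenchel_young w x s (q - 1) Hw Hx Hs) as H2.
    assert (Hqm : INR q = INR (q - 1) + 1) by (rewrite <- S_INR; f_equal; lia).
    rewrite Hqm in H1.
    assert (Hr : INR (S r) <= INR N) by (apply le_INR; lia).
    pose proof (pos_INR (S r)).
    set (F := phi_of w s / x) in *. set (A := INR (q - 1) * s - log_W w x (q - 1)) in *.
    set (B := s - (log_W w x q - log_W w x (q - 1))) in *.
    assert (H3 : A + B <= F) by (unfold A, B; lra).
    assert (INR N * A + INR (S r) * B <= INR N * F); [nra|lra].
Qed.

Lemma nat_ceil (r : R) : 0 <= r -> exists n : nat, r <= INR n <= r + 1.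
Proof.
  intros Hr. destruct (archimed r) as [H1 H2].
  exists (Z.to_nat (up r)).
  rewrite INR_IZR_INZ, Z2Nat.id; [lra|]. apply le_IZR. lra.
Qed.

(** With [t = e^s], biconjugation at [s + l] gives a slope [u]; rounding it down to a multiple
    [y * K] costs at most [y * (s + l)], and [good_conjugate_bound] estimates what remains. The
    terms in [s] are absorbed by [s <= w t + M]. *)
Lemma good_concave_growth (w : R -> R) :
  weight_function w -> normalized w -> good w -> concave_growth w.
Proof.
  intros Hw Hn Hgood. destruct (Hgood 1 Rlt_0_1) as (y & Hy & C & HC & H).
  destruct (weight_function_affine_bound w Hw) as (a & Ha & Haff).
  destruct (phi_of_superlinear w 1 Hw Rle_0_1) as (M & HM & Hlin).
  (* [E0] collects the coefficients of [Hmain] once [N] is factored out and [s] is replaced by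
     [w t + M]. *)
  set (E0 := 4 * y + 2 * (y * M) + 2 * a + 1).
  exists (2 * C * E0).
  assert (HE0 : 1 <= E0) by (unfold E0; nra).
  split; [nra|].
  intros t lam Ht Hlam.
  (* [N >= C * lam] gives [lam * t <= exp (s + l)], while [N <= 2 * C * lam] keeps the final bound
     linear in [lam]. *)
  destruct (nat_ceil (C * lam)) as (N & HN1 & HN2); [nra|].
  assert (HCN : C <= INR N) by nra.
  set (s := ln t). set (l := ln (INR N / C)).
  assert (HNC : 1 <= INR N / C).
  { apply Rmult_le_reg_r with C; [lra|]. field_simplify; lra. }
  assert (HNCN : INR N / C <= INR N).
  { apply Rmult_le_reg_r with C; [lra|]. field_simplify; [nra|lra]. }
  assert (Hl : 0 <= l) by (apply ln_nonneg; exact HNC).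
  assert (Hs : 0 <= s) by (apply ln_nonneg; exact Ht).
  assert (Hphis : phi_of w s = w t) by (unfold phi_of, s; rewrite exp_ln by lra; reflexivity).
  assert (Hphil : phi_of w l <= a + a * INR N).
  { unfold phi_of, l. rewrite exp_ln by lra. pose proof (Haff (INR N / C) ltac:(lra)). nra. }
  assert (HlN : l <= INR N).
  { pose proof (exp_ineq1_le l) as He. unfold l in He at 2. rewrite exp_ln in He by lra. lra. }
  assert (Hmono : w (lam * t) <= phi_of w (s + l)).
  { unfold phi_of. rewrite exp_plus. unfold s, l. rewrite !exp_ln by lra.
    apply weight_function_monotone; [exact Hw|nra|].
    apply Rmult_le_reg_r with C; [lra|]. field_simplify; [nra|lra]. }
  destruct (phi_of_biconjugate w (s + l) Hw ltac:(lra)) as (u & Hu & Hphi).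
  assert (HK : exists K : nat, y * INR K <= u <= y * INR K + y).
  { destruct (nat_ceil (u / y)) as (K & HK1 & HK2).
    { apply Rmult_le_pos; [exact Hu|left; apply Rinv_0_lt_compat, Hy]. }
    assert (Hdiv : u / y * y = u) by (field; lra).
    (* The ceiling minus one is a floor up to one unit; if the ceiling is 0 then [u = 0], and
       truncated subtraction gives the right value 0. *)
    exists (K - 1)%nat. destruct K as [|K].
    - simpl in *. nra.
    - replace (S K - 1)%nat with K by lia. rewrite S_INR in *. nra. }
  destruct HK as (K & HK1 & HK2).
  assert (HKpos : 0 <= y * INR K) by (pose proof (pos_INR K); nra).
  pose proof (phi_star_monotone w _ _ Hw HKpos HK1) as Hstar.
  assert (HlW : phi_star w (y * INR K) = y * log_W w y K) by (unfold log_W; field; lra).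
  pose proof (good_conjugate_bound w 1 y C s N K Hw Hn Rlt_0_1 Hy HC H HCN Hs) as Hb.
  fold l in Hb. rewrite Hphis in Hb.
  apply Rmult_le_compat_l with (r := y) in Hb; [|lra].
  replace (y * (INR N * s + phi_of w l / y + INR N * (w t / 1)))
    with (y * INR N * s + phi_of w l + INR N * y * w t) in Hb by (field; lra).
  specialize (Hlin s Hs). rewrite Hphis in Hlin.
  assert (Hwt : 0 <= w t) by (apply weight_function_nonneg; [exact Hw|lra]).
  assert (Hmain : phi_of w (s + l) <= y * INR N * s + (a + a * INR N) + INR N * y * w t + y * s + y * INR N).
  { assert ((s + l) * u <= (s + l) * (y * INR K + y)) by (apply Rmult_le_compat_l; lra).
    assert (y * l <= y * INR N) by (apply Rmult_le_compat_l; lra). nra. }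
  assert (HsM : s <= w t + M) by lra.
  assert (HN0 : 1 <= INR N) by lra.
  assert (Hfin : phi_of w (s + l) <= INR N * E0 * (w t + 1)).
  { assert (Hys : y * s <= y * (w t + M)) by (apply Rmult_le_compat_l; lra).
    assert (HyNs : INR N * (y * s) <= INR N * (y * (w t + M))) by (apply Rmult_le_compat_l; lra).
    assert (0 <= y * (w t + M)) by nra.
    assert (y * (w t + M) <= INR N * (y * (w t + M))) by nra.
    assert (a <= INR N * a) by nra.
    apply Rle_trans with (INR N * (2 * (y * (w t + M)) + 2 * a + y * w t + y)); [nra|].
    rewrite Rmult_assoc. apply Rmult_le_compat_l; [lra|]. unfold E0.
    assert (0 <= y * M) by nra. nra. }
  assert (HN3 : INR N <= 2 * C * lam) by nra.
  apply Rle_trans with (INR N * E0 * (w t + 1)); [lra|].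
  replace (2 * C * E0 * lam * (w t + 1)) with (2 * C * lam * (E0 * (w t + 1))) by ring.
  rewrite Rmult_assoc. apply Rmult_le_compat_r; [nra|exact HN3].
Qed.

(** * From the growth bound and the root condition to goodness *)

Lemma concave_growth_good (w : R -> R) :
  weight_function w -> normalized w -> theta_root_condition w -> concave_growth w -> good w.
Proof.
  intros Hw Hn Hroot (E & HE & Hgrow) x Hx.
  destruct (Hroot x Hx) as (y & Hy & A & HA & Hth).
  (* [A] comes from the root condition and [E] from the growth bound; [exp (/ y)] pays for the
     additive 1 in the latter. *)
  exists y. split; [exact Hy|]. exists (Rmax 1 (A * E * exp (/ y))). split; [apply Rmax_l|].
  intros j k Hj Hjk.
  assert (Hk : (1 <= k)%nat) by lia.
  assert (Hinvy : 0 < / y) by (apply Rinv_0_lt_compat, Hy).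
  assert (Hj' := le_INR _ _ Hj). assert (Hk' := le_INR _ _ Hk). assert (Hjk' := le_INR _ _ Hjk).
  simpl in Hj', Hk'.
  set (d := log_W w y k - log_W w y (k - 1)).
  assert (Hd : / INR k * log_W w y k <= d).
  { pose proof (log_W_root_le w y (k - 1) k Hw Hy ltac:(lia) Hk) as H.
    assert (Hk1 : INR k = INR (k - 1) + 1) by (rewrite <- S_INR; f_equal; lia).
    replace (INR (k - 1)) with (INR k - 1) in H by lra.
    replace ((INR k - 1) / INR k * log_W w y k) with (log_W w y k - / INR k * log_W w y k) in H
      by (field; lra).
    unfold d. lra. }
  (* In exponential form: [(W^y_j)^(1/j) / j] is at most [E * exp (/ y)] times [(W^y_k)^(1/k) / k].
     If [k < E * j] the logarithm is negative and monotone roots suffice; otherwise the growth bound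
     is conjugated. *)
  assert (Hkey : / INR j * log_W w y j + ln (INR k / (E * INR j)) - / y <= / INR k * log_W w y k).
  { assert (Hq : 0 < INR k / (E * INR j)).
    { apply Rmult_lt_0_compat; [lra|apply Rinv_0_lt_compat; nra]. }
    destruct (Rle_dec (E * INR j) (INR k)) as [h|h].
    - assert (Hq1 : 1 <= INR k / (E * INR j)).
      { apply Rmult_le_reg_r with (E * INR j); [nra|]. field_simplify; [lra|nra]. }
      (* This shift makes the growth factor [E * exp l] equal to [k / j], the ratio of the two
         arguments of [phi_star]. *)
      set (l := ln (INR k / (E * INR j))).
      assert (Hl : 0 <= l) by (apply ln_nonneg; exact Hq1).
      assert (Hel : E * exp l = INR k / INR j).
      { unfold l. rewrite exp_ln by exact Hq. field. lra. }
      set (c := INR k / INR j) in *.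
      assert (Hc : 0 < c) by (unfold c; apply Rmult_lt_0_compat; [lra|apply Rinv_0_lt_compat; lra]).
      assert (Hphi : forall s, 0 <= s -> phi_of w (s + l) <= c * (phi_of w s + 1)).
      { intros s Hs. unfold phi_of. rewrite exp_plus, (Rmult_comm (exp s)), <- Hel.
        apply Hgrow; apply exp_ge_1; assumption. }
      (* Fenchel-Young at the shifted point [s + l] yields the gain [y * INR j * l], which becomes
         [l] after division by [y * INR j]. *)
      assert (Hstar : phi_star w (y * INR j) <= / c * phi_star w (y * INR k) - y * INR j * l + 1).
      { apply phi_star_le. intros s Hs. specialize (Hphi s Hs).
        pose proof (fenchel_young w (s + l) (y * INR k) Hw ltac:(lra) ltac:(nra)) as HF.
        replace (y * INR k) with (c * (y * INR j)) in HF |- * by (unfold c; field; lra).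
        apply Rmult_le_reg_l with c; [exact Hc|].
        replace (c * (/ c * phi_star w (c * (y * INR j)) - y * INR j * l + 1))
          with (phi_star w (c * (y * INR j)) - c * (y * INR j) * l + c) by (field; lra).
        nra. }
      assert (Hj0 : / (y * INR j) <= / y) by (apply Rinv_le_contravar; [lra|nra]).
      apply Rmult_le_compat_l with (r := / (y * INR j)) in Hstar;
        [|left; apply Rinv_0_lt_compat; nra].
      replace (/ (y * INR j) * (/ c * phi_star w (y * INR k) - y * INR j * l + 1))
        with (/ INR k * (/ y * phi_star w (y * INR k)) - l + / (y * INR j)) in Hstar
        by (unfold c; field; lra).
      unfold log_W. rewrite Rinv_mult in Hstar at 1. lra.
    - pose proof (log_W_root_le w y j k Hw Hy Hjk Hk) as H.
      apply Rmult_le_compat_l with (r := / INR j) in H; [|left; apply Rinv_0_lt_compat; lra].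
      replace (/ INR j * (INR j / INR k * log_W w y k)) with (/ INR k * log_W w y k) in H
        by (field; lra).
      assert (Hln : ln (INR k / (E * INR j)) < ln 1).
      { apply ln_increasing; [exact Hq|].
        apply Rmult_lt_reg_r with (E * INR j); [nra|]. field_simplify; [lra|nra]. }
      rewrite ln_1 in Hln. lra. }
  specialize (Hth j Hj). unfold Rpower in Hth.
  rewrite W_exp_log_W, ln_exp in Hth.
  assert (Hexp : exp (/ INR j * log_W w y j) * (INR k / (E * INR j)) <= exp (/ y) * theta w y k).
  { rewrite theta_exp. fold d.
    rewrite <- (exp_ln (INR k / (E * INR j))) by
      (apply Rmult_lt_0_compat; [lra|apply Rinv_0_lt_compat; nra]).
    rewrite <- !exp_plus.
    destruct (Req_dec (/ INR j * log_W w y j + ln (INR k / (E * INR j))) (/ y + d)) as [h|h].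
    - rewrite h. lra.
    - left. apply exp_increasing. lra. }
  assert (Hpos : 0 < theta w y k / INR k).
  { rewrite theta_exp. apply Rmult_lt_0_compat; [apply exp_pos|apply Rinv_0_lt_compat; lra]. }
  apply Rle_trans with (A * E * exp (/ y) * (theta w y k / INR k)).
  - apply Rle_trans with (A * exp (/ INR j * log_W w y j) / INR j).
    + apply Rmult_le_compat_r; [left; apply Rinv_0_lt_compat; lra|exact Hth].
    + apply Rmult_le_compat_l with (r := A * E / INR k) in Hexp;
        [|apply Rmult_le_pos; [nra|left; apply Rinv_0_lt_compat; lra]].
      eapply Rle_trans; [|eapply Rle_trans; [exact Hexp|]]; right; field; lra.
  - apply Rmult_le_compat_r; [lra|apply Rmax_r].
Qed.

(** * The growth bound and the least concave majorant *)

Lemma concave_growth_equivalent (w : R -> R) :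
  weight_function w -> concave_growth w ->
  exists kappa, least_concave_majorant w kappa /\ equivalent w kappa.
Proof.
  intros Hw (E & HE & Hgrow).
  destruct (weight_function_affine_bound w Hw) as (a & Ha & Haff).
  destruct (least_concave_majorant_exists w (fun t => a + a * t)) as [kappa Hk].
  { split; [apply concave_on_nonneg_affine|exact Haff]. }
  exists kappa. split; [exact Hk|]. destruct Hk as [[_ Hmaj] Hleast].
  (* Beyond [T] one has [w t >= 1], so [w t + 1 <= 2 * w t]; this is the 2 in [1 + 2 * E]. *)
  pose proof Hw as (_ & _ & _ & _ & Hinf & _). destruct (Hinf 1) as [T HT].
  split.
  - exists 1, 0. intros t Ht. pose proof (weight_function_nonneg w t Hw Ht). specialize (Hmaj t Ht).
    rewrite !Rabs_pos_eq by lra. lra.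
  - exists (1 + 2 * E), (Rmax T 1). intros t Ht.
    pose proof (Rmax_l T 1). pose proof (Rmax_r T 1).
    assert (Hwt : 1 <= w t) by (apply HT; lra).
    pose proof (Hmaj t ltac:(lra)). rewrite !Rabs_pos_eq by lra.
    eapply Rle_trans.
    (* For fixed [t] this affine function dominates [w]: by monotonicity for [s <= t], and by the
       growth bound with factor [s / t] beyond. Its value at [t] is [(1 + 2 * E) * w t]. *)
    + apply (Hleast (fun s => w t + 2 * E * w t / t * s)); [|lra].
      split; [apply concave_on_nonneg_affine|]. intros s Hs.
      assert (Hpos : 0 <= 2 * E * w t / t).
      { apply Rmult_le_pos; [nra|left; apply Rinv_0_lt_compat; lra]. }
      destruct (Rle_dec s t) as [h|h].
      * pose proof (weight_function_monotone w s t Hw Hs h). nra.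
      * assert (Hst : 1 <= s / t).
        { apply Rmult_le_reg_r with t; [lra|]. field_simplify; lra. }
        pose proof (Hgrow t (s / t) ltac:(lra) Hst) as H2.
        replace (s / t * t) with s in H2 by (field; lra).
        replace (2 * E * w t / t * s) with (E * (s / t) * (2 * w t)) by (field; lra).
        assert (E * (s / t) * (w t + 1) <= E * (s / t) * (2 * w t)); [|lra].
        apply Rmult_le_compat_l; nra.
    + right. field. lra.
Qed.

(** Concavity between 0 and [l * t], with [kappa 0 >= w 0 = 0], gives
    [kappa (l * t) <= l * kappa t], and equivalence returns to [w] beyond a threshold [S]. Below it,
    monotonicity compares [t] with [S], at the cost of a constant multiple of [l * w S]. *)
Lemma equivalent_concave_growth (w kappa : R -> R) :
  weight_function w -> concave_majorant w kappa -> equivalent w kappa -> concave_growth w.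
Proof.
  intros Hw [Hconc Hmaj] [_ (C & T & HC)].
  set (S := Rmax T 1). assert (HS1 : 1 <= S) by apply Rmax_r. assert (HST : T <= S) by apply Rmax_l.
  assert (HC0 : forall t, S <= t -> 0 <= t -> kappa t <= Rabs C * w t).
  { intros t Ht Ht0. specialize (HC t ltac:(lra)).
    pose proof (Hmaj t Ht0). pose proof (weight_function_nonneg w t Hw Ht0).
    rewrite !Rabs_pos_eq in HC by lra. pose proof (Rle_abs C). nra. }
  pose proof Hw as (_ & _ & _ & Hw0 & _).
  assert (Hk0 : 0 <= kappa 0) by (pose proof (Hmaj 0 (Rle_refl 0)); lra).
  assert (Hscale : forall t l, S <= t -> 1 <= l -> w (l * t) <= l * (Rabs C * w t)).
  { intros t l Ht Hl.
    assert (Hil : 0 <= / l <= 1).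
    { split; [left; apply Rinv_0_lt_compat; lra|]. rewrite <- Rinv_1. apply Rinv_le_contravar; lra. }
    pose proof (Hconc (l * t) 0 (/ l) ltac:(nra) (Rle_refl 0) Hil) as H.
    replace (/ l * (l * t) + (1 - / l) * 0) with t in H by (field; lra).
    assert (H1 : / l * kappa (l * t) <= kappa t) by nra.
    apply Rmult_le_compat_l with (r := l) in H1; [|lra].
    replace (l * (/ l * kappa (l * t))) with (kappa (l * t)) in H1 by (field; lra).
    pose proof (Hmaj (l * t) ltac:(nra)). specialize (HC0 t Ht ltac:(lra)).
    assert (l * kappa t <= l * (Rabs C * w t)) by (apply Rmult_le_compat_l; lra). lra. }
  pose proof (Rabs_pos C) as HC1.
  assert (HwS : 0 <= w S) by (apply weight_function_nonneg; [exact Hw|lra]).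
  exists (1 + Rabs C * (1 + w S)). split; [nra|]. intros t l Ht Hl.
  assert (Hwt : 0 <= w t) by (apply weight_function_nonneg; [exact Hw|lra]).
  assert (HCS : 0 <= Rabs C * w S) by nra. assert (HCt : 0 <= Rabs C * w t) by nra.
  assert (H : w (l * t) <= l * (Rabs C * w t + Rabs C * w S)).
  { destruct (Rle_dec S t) as [h|h].
    - specialize (Hscale t l h Hl). nra.
    - specialize (Hscale S l (Rle_refl S) Hl).
      pose proof (weight_function_monotone w (l * t) (l * S) Hw ltac:(nra) ltac:(nra)). nra. }
  eapply Rle_trans; [exact H|].
  rewrite (Rmult_comm _ l), Rmult_assoc. apply Rmult_le_compat_l; [lra|]. nra.
Qed.

Theorem theorem3p18 (w : R -> R) :
  weight_function w -> normalized w -> theta_root_condition w ->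
  (good w <-> exists kappa, least_concave_majorant w kappa /\ equivalent w kappa).
Proof.
  intros Hw Hn Hroot. split.
  - intros Hgood. apply concave_growth_equivalent; [exact Hw|].
    apply good_concave_growth; assumption.
  - intros (kappa & [Hmaj _] & Heq). apply concave_growth_good; try assumption.
    exact (equivalent_concave_growth w kappa Hw Hmaj Heq).
Qed.
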